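(* Let $I\subset\mathbb{K}[\mathbb{P}^n]$ be a radical homogeneous ideal with linearly bounded symbolic regularity. Then the asymptotic Hilbert polynomial $\operatorname{aHP}_I(t)$ is a polynomial in $t$.
   Context: $\mathbb{K}$ is an algebraically closed field of characteristic zero, $n$ is a positive integer, and $\mathbb{K}[\mathbb{P}^n]=\mathbb{K}[x_1,\dots,x_{n+1}]$ with the standard grading. The $m$-th symbolic power of a homogeneous radical ideal $I$ is $I^{(m)}=\mathbb{K}[\mathbb{P}^n]\cap\bigcap_{Q\in\operatorname{Ass}(I)}(I^m)_Q$, where the localizations are embedded in the field of fractions of $\mathbb{K}[\mathbb{P}^n]$. For a homogeneous ideal $J$, $\operatorname{HP}_J$ is the Hilbert polynomial, i.e. the polynomial agreeing with $\dim_{\mathbb{K}}(\mathbb{K}[\mathbb{P}^n]_t/J_t)$ for $t\gg0$. The asymptotic Hilbert polynomial of $I$ is the function $$\operatorname{aHP}_I(t)=\lim_{m\to\infty}\frac{\operatorname{HP}_{I^{(m)}}(mt)}{m^n}.$$ $I$ has linearly bounded symbolic regularity (is LBSR) if there exist constants $a,b>0$ such that $\operatorname{reg}(I^{(m)})\le am+b$ for all sufficiently large $m$, where $\operatorname{reg}$ is the Castelnuovo–Mumford regularity. *)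

(* Defs.v *)
From HB Require Import structures.
From mathcomp Require Import all_boot all_order all_algebra.
From mathcomp Require Import mpoly.
From mathcomp Require Import boolp classical_sets constructive_ereal reals.
From mathcomp Require Import ereal topology normedtype sequences.

Set Implicit Arguments.
Unset Strict Implicit.
Unset Printing Implicit Defensive.

Import Order.TTheory GRing.Theory Num.Theory.
Import numFieldNormedType.Exports.

Local Open Scope classical_set_scope.
Local Open Scope ring_scope.

(* The ring K[x_1, ..., x_(n+1)]. *)
Notation coord_ring K n := {mpoly K[n.+1]} (only parsing).

Section Ideals.
Context {A : idomainType}.
Implicit Types I J Q : set A.

Definition is_ideal I : Prop :=
  [/\ I 0, forall f g, I f -> I g -> I (f + g) & forall r f, I f -> I (r * f)].

Definition is_radical I : Prop := forall f k, I (f ^+ k) -> I f.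

Definition is_prime Q : Prop :=
  [/\ is_ideal Q, ~ Q 1 & forall f g, Q (f * g) -> Q f \/ Q g].

Definition ideal_mul I J : set A :=
  [set h | exists (k : nat) (a b : 'I_k -> A),
    [/\ forall i, I (a i), forall i, J (b i) & h = \sum_(i < k) a i * b i]].

Definition ideal_pow I (m : nat) : set A := iter m (ideal_mul I) setT.

(* Ass(I) means Ass(A/I): the prime ideals of the form (I : f). *)
Definition assoc_prime I : set (set A) :=
  [set Q | is_prime Q /\ exists f, Q = [set g | I (g * f)]].

(* J_Q as a subset of Frac(A). *)
Definition localize J Q : set {fraction A} :=
  [set x | exists a s, [/\ J a, ~ Q s & x = tofrac a / tofrac s]].

(* When I is the unit ideal, Ass(I) is empty and I^(m) is the whole ring. *)
Definition symbolic_pow I (m : nat) : set A :=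
  [set f | forall Q, assoc_prime I Q -> localize (ideal_pow I m) Q (tofrac f)].

End Ideals.

Section Graded.
Context {K : fieldType} {N : nat}.
Local Notation S := {mpoly K[N]}.
Implicit Types (J : set S).

Definition is_homogeneous J : Prop :=
  forall f (d : nat), J f -> J (pihomog mdeg d f).

(* The classes of b_0, ..., b_(d-1) form a K-basis of S_t / J_t. *)
Definition quotient_basis J (t d : nat) (b : 'I_d -> S) : Prop :=
  (forall i, b i \is t.-homog) /\
  forall f, f \is t.-homog ->
    exists! c : 'rV[K]_d, J (f - \sum_(i < d) c 0 i *: b i).

(* dim_K (S_t / J_t) *)
Definition hilbert_function J (t : nat) : nat :=
  xget 0%N [set d | exists b : 'I_d -> S, quotient_basis J t b].

(* The Hilbert polynomial, viewed in R[t]. The default value 0 is irrelevant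
   for homogeneous ideals, which always have a unique Hilbert polynomial. *)
Definition hilbert_poly (R : realType) J : {poly R} :=
  xget 0 [set p : {poly R} | exists t0 : nat, forall t : nat, (t0 <= t)%N ->
    (hilbert_function J t)%:R = p.[t%:R]].

(* A finite minimal graded free resolution
     ... -> F_1 -> F_0 -> J -> 0,   F_i = \oplus_(j < rk i) S(- sh i j),
   of J as an S-module. Maps are matrices acting on row vectors on the right;
   being of degree 0 means that the entry of dif i in row k and column j is
   homogeneous of degree sh i.+1 k - sh i j (so it is 0 when that number is
   negative). *)
Record min_free_resolution J := MinFreeResolution {
  rk : nat -> nat;
  sh : forall i, 'I_(rk i) -> int;
  len : nat;
  aug : 'cV[S]_(rk 0);
  dif : forall i, 'M[S]_(rk i.+1, rk i);
  rk_len : forall i, (len <= i)%N -> rk i = 0%N;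
  aug_homog : forall k m, m \in msupp (aug k 0) -> (mdeg m)%:Z = sh k;
  dif_homog : forall i k j m, m \in msupp (dif i k j) ->
    (mdeg m)%:Z = sh k - sh j;
  aug_image : forall f, J f <-> exists u : 'rV_(rk 0), f = (u *m aug) 0 0;
  exact_aug : forall u : 'rV_(rk 0),
    u *m aug = 0 <-> exists v : 'rV_(rk 1), u = v *m dif 0;
  exact_dif : forall i (u : 'rV_(rk i.+1)),
    u *m dif i = 0 <-> exists v : 'rV_(rk i.+2), u = v *m dif i.+1;
  (* im (dif i) is contained in (x_1, ..., x_N) F_i *)
  minimality : forall i k j, (dif i k j)@_0%MM = 0
}.

(* max_(i, j) (sh i j - i), equal to -oo for the empty resolution of J = 0 *)
Definition resolution_reg J (F : min_free_resolution J) : \bar int :=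
  (\big[maxe/-oo]_(i < len F) \big[maxe/-oo]_(j < rk F i)
     (sh j - i%:Z)%:E)%E.

(* The Castelnuovo-Mumford regularity of J as a module. The minimal graded free
   resolution of a homogeneous ideal exists and is unique up to isomorphism;
   where there is no such resolution the value is +oo by convention. *)
Definition regularity J : \bar int :=
  xget (+oo)%E (range (@resolution_reg J)).

Definition LBSR (R : realType) (I : set S) : Prop :=
  exists a b : R, [/\ 0 < a, 0 < b & \forall m \near \oo,
    (er_map (fun z : int => z%:~R) (regularity (symbolic_pow I m))
       <= (a * m%:R + b)%:E)%E].

End Graded.

Section AsymptoticHilbertPolynomial.
Context {R : realType} {K : fieldType} {n : nat}.
Implicit Type I : set (coord_ring K n).

Definition aHP_seq I (t : R) : R^nat :=
  fun m => (hilbert_poly R (symbolic_pow I m)).[m%:R * t] / m%:R ^+ n.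

Definition aHP I (t : R) : R := lim (aHP_seq I t @ \oo).

End AsymptoticHilbertPolynomial.

(* Main.v *)
Require Import Defs.
From mathcomp Require Import all_boot all_order all_algebra.
From mathcomp Require Import mpoly.
From mathcomp Require Import boolp classical_sets constructive_ereal reals.
From mathcomp Require Import ereal topology normedtype sequences.
From mathcomp Require Import ring zify.

(* Writing J_m for the symbolic power I^(m), let c_m(s) be the number of
   monomials of degree at most s that are not leading monomials of forms in J_m,
   that is, the sum of the Hilbert functions of J_m up to s. As J_p^k is
   contained in J_(pk), and J_(pk) in J_m for m <= pk, dividing exponents by k
   gives c_m(mT) <= k^(n+1) c_p(pT) with k about m/p, so c_m(mT) / m^(n+1)
   converges (to its infimum) for every natural number T.

   A minimal free resolution has length at most n + 1, so a linear bound on the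
   regularity makes all its shifts linear in m. Hence, for T large, mT lies in
   the range where the Hilbert function is polynomial, and
   c_m(mT) = m^(n+1) r_m(T) for a polynomial r_m of degree at most n+1. By
   Lagrange interpolation at n+2 such points, the r_m converge to a polynomial
   r, and HP_(J_m)(mt) / m^n = m (r_m(t) - r_m(t - 1/m)) converges to r'(t). *)

Set Implicit Arguments.
Unset Strict Implicit.
Unset Printing Implicit Defensive.

Import Order.TTheory GRing.Theory Num.Theory.
Import numFieldNormedType.Exports.

Local Open Scope classical_set_scope.
Local Open Scope ring_scope.

(** * Dimension of quotients of subspaces *)

Section Dimension.
Context {K : fieldType}.

Definition subspace (V : lmodType K) (W : set V) : Prop :=
  W 0 /\ forall a u v, W u -> W v -> W (a *: u + v).

(* dim W / (W `&` J) = d. When W is the space of forms of degree t, this unfolds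
   to the existence of a [quotient_basis J t] of size d. *)
Definition has_dim (V : lmodType K) (W J : set V) (d : nat) : Prop :=
  exists b : 'I_d -> V, (forall i, W (b i)) /\
    forall f, W f -> exists! c : 'rV[K]_d, J (f - \sum_(i < d) c 0 i *: b i).

Section Subspace.
Context {V : lmodType K} {W : set V} (subW : subspace W).

Lemma subspaceZ a u : W u -> W (a *: u).
Proof. by move=> Wu; rewrite -[X in W X]addr0; apply: subW.2 => //; apply: subW.1. Qed.

Lemma subspaceD u v : W u -> W v -> W (u + v).
Proof. by move=> Wu Wv; rewrite -[u]scale1r; apply: subW.2. Qed.

Lemma subspaceB u v : W u -> W v -> W (u - v).
Proof. by move=> Wu Wv; rewrite addrC -scaleN1r; apply: subW.2. Qed.

Lemma subspace_sum (I : finType) (F : I -> V) : (forall i, W (F i)) -> W (\sum_i F i).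
Proof.
move=> WF; elim/big_rec: _ => [|i x _ Wx]; first exact: subW.1.
exact: subspaceD.
Qed.

End Subspace.

Lemma subspace0 (V : lmodType K) : subspace [set 0 : V].
Proof. by split=> // a u v /= -> ->; rewrite scaler0 addr0. Qed.

Definition comb (V : lmodType K) d (b : 'I_d -> V) (c : 'rV[K]_d) : V :=
  \sum_(i < d) c 0 i *: b i.

Lemma combP (V : lmodType K) d (b : 'I_d -> V) a u v :
  comb b (a *: u + v) = a *: comb b u + comb b v.
Proof.
rewrite /comb scaler_sumr -big_split /=.
by apply: eq_bigr => i _; rewrite !mxE scalerDl scalerA.
Qed.

Lemma comb0 (V : lmodType K) d (b : 'I_d -> V) : comb b 0 = 0.
Proof. by rewrite /comb big1 // => i _; rewrite mxE scale0r. Qed.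

Lemma combD (V : lmodType K) d (b : 'I_d -> V) u v :
  comb b (u + v) = comb b u + comb b v.
Proof. by rewrite -[u]scale1r combP !scale1r. Qed.

Lemma combZ (V : lmodType K) d (b : 'I_d -> V) a u : comb b (a *: u) = a *: comb b u.
Proof. by rewrite -[a *: u]addr0 combP comb0 addr0. Qed.

Lemma combB (V : lmodType K) d (b : 'I_d -> V) u v :
  comb b (u - v) = comb b u - comb b v.
Proof. by rewrite -[- v]scaleN1r combD combZ scaleN1r. Qed.

Lemma comb_delta (V : lmodType K) d (b : 'I_d -> V) i : comb b (delta_mx 0 i) = b i.
Proof.
rewrite /comb (bigD1 i) //= mxE !eqxx scale1r big1 ?addr0 // => j /negbTE ji.
by rewrite mxE ji andbF scale0r.
Qed.

Lemma comb_mul (V : lmodType K) d e (b : 'I_d -> V) (M : 'M[K]_(e, d)) c :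
  comb (fun i => comb b (row i M)) c = comb b (c *m M).
Proof.
rewrite mulmx_sum_row (big_morph (comb b) (combD b) (comb0 b)) [LHS]/comb.
by apply: eq_bigr => i _; rewrite combZ.
Qed.

Lemma subspace_comb (V : lmodType K) (W : set V) d (b : 'I_d -> V) c :
  subspace W -> (forall i, W (b i)) -> W (comb b c).
Proof. by move=> sW Wb; apply: (subspace_sum sW) => i; apply: subspaceZ. Qed.

(** Take a matrix of maximal rank among those whose row space lies in [P]: adding a further row of
    [P] cannot raise the rank, so that row already lies in the row space. *)
Lemma subspace_row d (P : set 'rV[K]_d) : subspace P ->
  exists A : 'M[K]_d, forall c, P c <-> (c <= A)%MS.
Proof.
move=> sP.
pose Q r := `[< exists A : 'M[K]_d, (forall c, (c <= A)%MS -> P c) /\ \rank A = r >].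
have exQ : exists r, Q r.
  exists 0; apply/asboolP; exists 0; split; last by rewrite mxrank0.
  by move=> c; rewrite submx0 => /eqP ->; apply: sP.1.
have ubQ r : Q r -> (r <= d)%N by move/asboolP => [A [_ <-]]; apply: rank_leq_row.
case: (ex_maxnP exQ ubQ) => r /asboolP[A [AP rA]] maxr.
exists A => c; split=> [Pc|]; last exact: AP.
have : Q (\rank (A + c)%MS).
  apply/asboolP; exists (A + c)%MS; split=> // x /sub_addsmxP[[u v] /= ->].
  apply: (subspaceD sP); first by apply: AP; apply: submxMl.
  have -> : v *m c = v 0 0 *: c.
    by apply/rowP => j; rewrite !mxE big_ord1 ord1.
  exact: subspaceZ.
move/maxr; rewrite -rA => le_r.
have /andP[_ sub] : (A == A + c)%MS.
  by rewrite -(geq_leqif (mxrank_leqif_eq (addsmxSl A c))).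
exact: submx_trans (addsmxSr A c) sub.
Qed.

(** In coordinates with respect to a basis of [W], [J] becomes the row space of a matrix [A]. A row
    basis of [A] gives a basis of [J], and a row basis of the complement [A^C] gives a basis of [W]
    modulo [J]. *)
Lemma has_dim_split (V : lmodType K) (W J : set V) d :
  subspace W -> subspace J -> J `<=` W -> has_dim W [set 0] d ->
  exists e g, [/\ has_dim J [set 0] e, has_dim W J g & d = (e + g)%N].
Proof.
move=> sW sJ JW [b [Wb bP]].
have cb f : W f -> exists2 c, f = comb b c & forall c', f = comb b c' -> c' = c.
  move=> /bP[c [/eqP]]; rewrite subr_eq0 => /eqP fc cu; exists c => // c' fc'.
  by apply/esym/cu => /=; rewrite [X in X - _]fc' subrr.
have cbI c c' : comb b c = comb b c' -> c = c'.
  have /cb[x _ xu] := subspace_comb c sW Wb.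
  by move=> e; rewrite (xu c') // (xu c).
have sP : subspace [set c | J (comb b c)].
  split=> [|a u v Ju Jv] /=; first by rewrite comb0; apply: sJ.1.
  by rewrite combP; apply: sJ.2.
have [A AP] := subspace_row sP.
have JA c : J (comb b c) <-> (c <= A)%MS := AP c.
exists (\rank A), (\rank (A^C)%MS); split; last first.
- by rewrite mxrank_compl subnKC // rank_leq_row.
- exists (fun i => comb b (row i (row_base (A^C)%MS))); split=> [i|f /cb[c -> cu]].
    exact: subspace_comb.
  have /sub_addsmxP[[u v] /= cuv] : (c <= A + A^C)%MS.
    exact/submx_full/addsmx_compl_full.
  have /submxP[x vx] : (v *m (A^C)%MS <= row_base (A^C)%MS)%MS.
    by rewrite eq_row_base submxMl.
  exists x; split=> [|y].
    rewrite -/(comb _ _) comb_mul -combB cuv vx addrK.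
    by apply/JA; apply: submxMl.
  rewrite -/(comb _ _) comb_mul -combB cuv vx -addrA -mulmxBl => /JA yA.
  (* Uniqueness: two coordinate vectors of the same class differ by a vector whose combination lies
     in both [A] and [A^C], hence is zero, and the rows of [row_base] are independent. *)
  have : ((x - y) *m row_base (A^C)%MS <= A :&: A^C)%MS.
    have sRB : (row_base (A^C)%MS <= A^C)%MS by rewrite eq_row_base.
    rewrite sub_capmx (submx_trans (submxMl _ _) sRB) andbT.
    by rewrite -[_ *m _](addKr (u *m A)) addmx_sub // -mulNmx submxMl.
  rewrite capmx_compl submx0 => /eqP e0.
  have /row_freeP[B BP] := row_base_free (A^C)%MS.
  apply/eqP; rewrite -subr_eq0; apply/eqP.
  by rewrite -[x - y]mulmx1 -BP mulmxA e0 mul0mx.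
- exists (fun i => comb b (row i (row_base A))); split=> [i|f Jf].
    by apply/JA; apply: submx_trans (row_sub _ _) _; rewrite eq_row_base.
  have /cb[c fc cu] := JW _ Jf.
  have sAR : (A <= row_base A)%MS by rewrite eq_row_base.
  move: Jf; rewrite fc => /JA/submx_trans/(_ sAR)/submxP[x cx].
  exists x; split=> [|y] /=.
    by rewrite -/(comb _ _) comb_mul -combB cx subrr comb0.
  move=> /eqP; rewrite -/(comb _ _) comb_mul subr_eq0 cx => /eqP/cbI e0.
  have /row_freeP[B BP] := row_base_free A.
  by rewrite -[x]mulmx1 -[y]mulmx1 -BP [LHS]mulmxA e0 -mulmxA.
Qed.

(** By uniqueness of coordinates modulo [J], the two change-of-basis matrices multiply to the
    identity of size [e], which therefore factors through size [d]. *)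
Lemma has_dim_le (V : lmodType K) (W J : set V) d e :
  subspace J -> has_dim W J d -> has_dim W J e -> (e <= d)%N.
Proof.
move=> sJ [b [Wb bP]] [b' [Wb' bP']].
have exM i : exists c, J (b' i - comb b c) by have [c [Jc _]] := bP _ (Wb' i); exists c.
have exM' i : exists c, J (b i - comb b' c) by have [c [Jc _]] := bP' _ (Wb i); exists c.
have [M MP] := choice exM; have [M' MP'] := choice exM'.
pose A := \matrix_i M i; pose A' := \matrix_i M' i.
suff AA : A *m A' = 1%:M by apply: mulmx1_min AA.
apply/row_matrixP => i; rewrite row1 row_mul rowK.
have [c [_ cu]] := bP' _ (Wb' i).
rewrite -(cu (delta_mx 0 i)); last first.
  by rewrite -/(comb _ _) comb_delta subrr; apply: sJ.1.
apply/esym/cu; rewrite -/(comb _ _) -comb_mul.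
rewrite -[X in J X](subrKA (comb b (M i))); apply: subspaceD => //.
rewrite /comb -sumrB; apply: subspace_sum => // j.
by rewrite -scalerBr rowK; apply: subspaceZ.
Qed.

Lemma has_dim_uniq (V : lmodType K) (W J : set V) d e :
  subspace J -> has_dim W J d -> has_dim W J e -> d = e.
Proof. by move=> sJ Wd We; apply/anti_leq; rewrite !(has_dim_le sJ Wd We, has_dim_le sJ We Wd). Qed.

Lemma has_dim_fin (V : lmodType K) (W J : set V) (I : finType) (b : I -> V) :
  subspace J -> (forall i, W (b i)) ->
  (forall f, W f -> exists c : I -> K, J (f - \sum_i c i *: b i)) ->
  (forall c : I -> K, J (\sum_i c i *: b i) -> forall i, c i = 0) ->
  has_dim W J #|I|.
Proof.
move=> sJ Wb spanb freeb.
have sumE (F : I -> V) : \sum_i F i = \sum_(j < #|I|) F (enum_val j).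
  by rewrite (reindex (@enum_val I I)) //; apply: onW_bij; apply: enum_val_bij.
exists (fun j => b (enum_val j)); split=> [//|f /spanb[c Jc]].
exists (\row_i c (enum_val i)); split=> [|x Jx].
  by move: Jc; rewrite sumE; congr (J (f - _)); apply: eq_bigr => j _; rewrite mxE.
have /freeb e : J (\sum_i (c i - x 0 (enum_rank i)) *: b i).
  have := subspaceB sJ Jx Jc; rewrite opprB addrC addrA subrK; congr J.
  rewrite sumE [in RHS]sumE -sumrB; apply: eq_bigr => i _.
  by rewrite scalerBl enum_valK.
by apply/rowP => i; have /eqP := e (enum_val i); rewrite mxE enum_valK subr_eq0 => /eqP.
Qed.

(** Rank-nullity: after splitting off the kernel, [L] carries a basis of [W] modulo the kernel to a
    basis of the image. *)
Lemma has_dim_image (V V' : lmodType K) (W : set V) (L : V -> V') d :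
  subspace W -> (forall a u v, L (a *: u + v) = a *: L u + L v) ->
  has_dim W [set 0] d ->
  exists e g, [/\ has_dim [set w | W w /\ L w = 0] [set 0] e,
    has_dim (L @` W) [set 0] g & d = (e + g)%N].
Proof.
move=> sW LP Wd.
have L0 : L 0 = 0 by have := LP (-1) 0 0; rewrite scaler0 addr0 scaleN1r addNr.
have LD u v : L (u + v) = L u + L v by rewrite -[u]scale1r LP !scale1r.
have LZ a u : L (a *: u) = a *: L u by rewrite -[a *: u]addr0 LP L0 addr0.
have sk : subspace [set w | W w /\ L w = 0].
  split=> [|a u v [Wu Lu] [Wv Lv]]; first by split=> //; apply: sW.1.
  by split; [apply: sW.2 | rewrite LP Lu Lv scaler0 addr0].
have [e [g [He Hg ->]]] := has_dim_split sW sk (fun w => @proj1 _ _) Wd.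
exists e, g; split=> //; case: Hg => b [Wb bP].
exists (L \o b); split=> [i|_ [f Wf <-]]; first by exists (b i).
have Lc c : L (f - comb b c) = L f - \sum_i c 0 i *: L (b i).
  rewrite LD -scaleN1r LZ scaleN1r /comb (big_morph L LD L0).
  by under eq_bigr do rewrite LZ.
have [c [[_ c0] cu]] := bP _ Wf; exists c; split=> [|c' c'0]; first by rewrite -Lc.
by apply: cu; split; [apply: subspaceB => //; apply: subspace_comb | rewrite Lc].
Qed.

End Dimension.

(** * Standard monomials *)

Section StandardMonomials.
Context {K : fieldType} {N : nat}.
Local Notation S := {mpoly K[N]}.
Implicit Types (J : set S).

Lemma ideal_subspace J : is_ideal J -> subspace J.
Proof.
move=> [J0 JD JM]; split=> // a u v Ju Jv; apply: JD => //.
by rewrite -mul_mpolyC; apply: JM.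
Qed.

Lemma homog_subspace s : subspace [set f : S | f \is s.-homog].
Proof. by split=> [|a u v hu hv] /=; [apply: rpred0 | rewrite rpredD ?rpredZ]. Qed.

(** The witnesses are forms, to match the Hilbert function, which only sees the forms in [J]. *)
Definition lead_set J : set 'X_{1..N} :=
  [set a | exists f, [/\ J f, f \is (mdeg a).-homog, f != 0 & mlead f = a]].

Definition standard J (a : 'X_{1..N}) : bool := ~~ `[< lead_set J a >].

Lemma mlead_cancel_lt (f g : S) c :
  mlead g = mlead f -> f@_(mlead f) = c * g@_(mlead f) ->
  f - c *: g != 0 -> (mlead (f - c *: g) < mlead f)%O.
Proof.
move=> lg fc nz; rewrite lt_neqAle; apply/andP; split.
  apply: contraNneq nz => e; rewrite -mleadc_eq0 e.
  by rewrite mcoeffB mcoeffZ fc subrr.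
apply: le_trans (mleadB_le _ _) _; rewrite leUx lexx /=.
by rewrite (le_trans (mleadZ_le _ _)) // lg.
Qed.

(** Macaulay's basis theorem: the standard monomials of degree [s] span modulo [J] by reducing
    leading monomials, and they are independent because a nonzero combination in [J] would have a
    standard leading monomial. The bound [B] makes the type of monomials finite. *)
Lemma has_dim_standard J s B : is_ideal J -> (s < B)%N ->
  has_dim [set f : S | f \is s.-homog] J
    #|[pred a : 'X_{1..N < B} | (mdeg a == s) && standard J a]|.
Proof.
move=> iJ sB; have sJ := ideal_subspace iJ.
pose I : finType := {a : 'X_{1..N < B} | (mdeg a == s) && standard J a}.
rewrite -card_sig -/I.
pose b (i : I) : S := 'X_[val (val i)].
have bc i j : (b i)@_(val (val j)) = (i == j)%:R by rewrite mcoeffX.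
have sumc (c : I -> K) i : (\sum_j c j *: b j)@_(val (val i)) = c i.
  rewrite raddf_sum (bigD1 i) //= mcoeffZ bc eqxx mulr1 big1 ?addr0 // => j /negbTE ji.
  by rewrite mcoeffZ bc ji mulr0.
apply: (has_dim_fin (b := b)) => // [i|f|c Jc].
- by rewrite /= dhomogX; case/andP: (valP i).
- elim/mleadrect: f => f IH /= hf.
  have [->|f0] := eqVneq f 0.
    exists (fun=> 0); rewrite big1 ?subrr; first exact: sJ.1.
    by move=> i _; rewrite scale0r.
  have df : mdeg (mlead f) = s by apply: (dhomogP _ _ _ hf); apply: mlead_supp.
  have [st|nst] := boolP (standard J (mlead f)).
    pose q := f - f@_(mlead f) *: 'X_[mlead f].
    have [c qc] : exists c : I -> K, J (q - \sum_i c i *: b i).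
      have [->|q0] := eqVneq q 0.
        exists (fun=> 0); rewrite big1 ?subrr; first exact: sJ.1.
        by move=> i _; rewrite scale0r.
      apply: IH; first exact: ltm_mleadD.
      by rewrite /= rpredB // rpredZ // dhomogX; apply/eqP.
    have lB : (mdeg (mlead f) < B)%N by rewrite df.
    have Pl : (fun a : 'X_{1..N < B} => (mdeg a == s) && standard J a) (BMultinom lB).
      by rewrite /= df eqxx.
    pose l : I := Sub (BMultinom lB) Pl.
    exists (fun i => c i + f@_(mlead f) * (i == l)%:R).
    rewrite (_ : f - _ = q - \sum_i c i *: b i) //.
    under eq_bigr do rewrite scalerDl; rewrite big_split /= [X in _ - (_ + X)](bigD1 l) //=.
    rewrite eqxx mulr1 [X in _ - (_ + (_ + X))]big1 => [|i /negbTE ->]; last first.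
      by rewrite mulr0 scale0r.
    by rewrite addr0 opprD addrA addrAC.
  (* The leading monomial of [f] is that of a form [g] in [J]: subtracting a multiple of [g] cancels
     it and keeps the class modulo [J]. *)
  move: nst; rewrite negbK => /asboolP[g [Jg hg g0 lg]].
  have gc : g@_(mlead f) != 0 by rewrite -lg mleadc_eq0.
  pose c0 := f@_(mlead f) / g@_(mlead f).
  have [c qc] : exists c : I -> K, J (f - c0 *: g - \sum_i c i *: b i).
    have [->|q0] := eqVneq (f - c0 *: g) 0.
      exists (fun=> 0); rewrite big1 ?subrr; first exact: sJ.1.
      by move=> i _; rewrite scale0r.
    apply: IH; first by apply: mlead_cancel_lt => //; rewrite /c0 mulfVK.
    by rewrite /= rpredB // rpredZ //; rewrite df in hg.
  exists c; have := subspaceD sJ qc (subspaceZ sJ c0 Jg).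
  by rewrite addrAC subrK.
- pose f := \sum_i c i *: b i.
  have hf : f \is s.-homog.
    by apply: rpred_sum => i _; rewrite rpredZ // dhomogX; case/andP: (valP i).
  suff f0 : f = 0 by move=> i; rewrite -sumc -/f f0 mcoeff0.
  apply/eqP; apply: contraT => f0.
  have df : mdeg (mlead f) = s by apply: (dhomogP _ _ _ hf); apply: mlead_supp.
  have : mlead f \in msupp f by apply: mlead_supp.
  rewrite mcoeff_msupp raddf_sum /= => nz.
  have [i ci] : exists i, (c i *: b i)@_(mlead f) != 0.
    apply/existsP; apply: contraNT nz => /existsPn h.
    by rewrite big1 // => i _; apply/eqP; have := h i; rewrite negbK.
  move: ci; rewrite mcoeffZ mcoeffX mulf_eq0 negb_or => /andP[_].
  have [e _|_] := eqVneq (val (val i)) (mlead f); last by rewrite eqxx.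
  have /andP[_ /negP] := valP i; case; apply/asboolP.
  by exists f; rewrite e df.
Qed.

Lemma hilbert_functionP J s d : is_ideal J ->
  has_dim [set f : S | f \is s.-homog] J d -> hilbert_function J s = d.
Proof.
move=> iJ hd; apply: xget_unique => // e he.
exact: (has_dim_uniq (ideal_subspace iJ) he hd).
Qed.

Lemma hilbert_function_standard J s B : is_ideal J -> (s < B)%N ->
  hilbert_function J s =
    #|[pred a : 'X_{1..N < B} | (mdeg a == s) && standard J a]|.
Proof. by move=> iJ sB; apply: hilbert_functionP => //; apply: has_dim_standard. Qed.

(** All degrees up to [t] are counted together because dividing exponents by k with rounding
    respects upper bounds on the degree, but does not map a single degree to a single degree. *)
Definition cumulative_hilbert J (t : nat) : nat :=
  #|[pred a : 'X_{1..N < t.+1} | standard J a]|.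

Lemma cumulative_hilbertE J t : is_ideal J ->
  cumulative_hilbert J t = (\sum_(s < t.+1) hilbert_function J s)%N.
Proof.
move=> iJ; under eq_bigr => s _ do
  rewrite (hilbert_function_standard iJ (ltn_ord s)) -sum1_card.
rewrite (exchange_big_dep (fun a : 'X_{1..N < t.+1} => standard J a)) /=; last first.
  by move=> s a _ /andP[].
rewrite /cumulative_hilbert -sum1_card; apply: eq_bigr => a sa.
rewrite sum1_card (eq_card (B := pred1 (Ordinal (bmdeg a)))) ?card1 // => s.
by rewrite !inE (sa : standard J a) unfold_in andbT eq_sym.
Qed.

Lemma lead_setD J a b : is_ideal J -> lead_set J a -> lead_set J (a + b)%MM.
Proof.
move=> [_ _ JM] [f [Jf hf f0 lf]]; exists ('X_[b] * f).
have X0 : 'X_[b] != 0 :> S by rewrite -msupp_eq0 msuppX.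
split; first exact: JM.
- by rewrite mdegD addnC; apply: dhomogM => //; rewrite dhomogX.
- by rewrite mulf_neq0.
- by rewrite mleadM // mleadXm lf addmC.
Qed.

(* The quotient map a |-> floor(a / k) sends standard monomials of J to standard
   monomials of J', and its fibres have at most k^N elements. *)
Lemma cumulative_hilbert_le J J' (t t' k : nat) : is_ideal J ->
  (0 < k)%N -> (t <= k * t')%N ->
  (forall a, lead_set J' a -> lead_set J (a *+ k)%MM) ->
  (cumulative_hilbert J t <= k ^ N * cumulative_hilbert J' t')%N.
Proof.
case: k => // k iJ _ tt' LL.
pose q (a : 'X_{1..N}) : 'X_{1..N} := [multinom (a i %/ k.+1)%N | i < N].
pose r (a : 'X_{1..N < t.+1}) := ([ffun i => inord (a i %% k.+1)] : {ffun 'I_N -> 'I_k.+1},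
                      (insubd bm0 (q a) : 'X_{1..N < t'.+1})).
have qdeg (a : 'X_{1..N < t.+1}) : (mdeg (q a) < t'.+1)%N.
  rewrite ltnS -(leq_pmul2l (ltn0Sn k)); apply: leq_trans tt'.
  rewrite -ltnS; apply: leq_ltn_trans (bmdeg a); rewrite !mdegE big_distrr /=.
  by apply: leq_sum => i _; rewrite mnmE mulnC leq_divM.
have -> : (k.+1 ^ N * cumulative_hilbert J' t')%N =
    #|[predX predT & [pred a : 'X_{1..N < t'.+1} | standard J' a]]
       : pred ({ffun 'I_N -> 'I_k.+1} * _)|.
  by rewrite cardX card_ffun !card_ord.
rewrite /cumulative_hilbert -(card_in_image (f := r)); last first.
  move=> a b _ _ [/ffunP e1 /(congr1 val)]; rewrite !val_insubd !qdeg => /mnmP e2.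
  apply/val_inj/mnmP => i /=; rewrite (divn_eq (a i) k.+1) (divn_eq (b i) k.+1).
  have := e2 i; rewrite !mnmE => ->.
  by have /(congr1 val) := e1 i; rewrite !ffunE /= !inordK ?ltn_mod // => ->.
apply: subset_leq_card; apply/fintype.subsetP => _ /fintype.imageP[a sa ->].
rewrite !inE /= val_insubd qdeg.
move: sa; rewrite inE; apply: contra => /asboolP/LL Lq; apply/asboolP.
(* If [q a] is a leading monomial of [J'], then [q a *+ k.+1] is one of [J], and so is its multiple
   [a]. *)
have -> : val a = ((q a *+ k.+1) + [multinom a i %% k.+1 | i < N])%MM.
  by apply/mnmP => i; rewrite mnmDE mulmnE !mnmE -divn_eq.
exact: lead_setD.
Qed.

End StandardMonomials.

(** * Symbolic powers *)

Section SymbolicPowers.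
Context {A : idomainType}.
Implicit Types I J Q : set A.

Lemma ideal_mul_ideal I J : is_ideal J -> is_ideal (ideal_mul I J).
Proof.
move=> [J0 JD JM]; split.
- by exists 0%N, (fun=> 0), (fun=> 0); split; [case|case|rewrite big_ord0].
- move=> _ _ [k [a [b [Ia Jb ->]]]] [l [c [d [Ic Jd ->]]]].
  exists (k + l)%N.
  exists (fun i => match split i with inl j => a j | inr j => c j end).
  exists (fun i => match split i with inl j => b j | inr j => d j end).
  split=> [i|i|]; try by case: (split i).
  rewrite big_split_ord /=; congr (_ + _); apply: eq_bigr => i _.
    by rewrite (unsplitK (inl i)).
  by rewrite (unsplitK (inr i)).
- move=> r _ [k [a [b [Ia Jb ->]]]]; exists k, a, (fun i => r * b i).
  split=> // [i|]; first exact: JM.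
  by rewrite mulr_sumr; apply: eq_bigr => i _; rewrite mulrCA.
Qed.

Lemma ideal_pow_ideal I m : is_ideal (ideal_pow I m).
Proof. by elim: m => [|m IH]; [split | apply: ideal_mul_ideal]. Qed.

Lemma ideal_sum J k (a : 'I_k -> A) :
  is_ideal J -> (forall i, J (a i)) -> J (\sum_i a i).
Proof.
move=> [J0 JD _] Ja; elim/big_rec: _ => [//|i x _ Jx]; exact: JD.
Qed.

Lemma ideal_powM I m k f g :
  ideal_pow I m f -> ideal_pow I k g -> ideal_pow I (m + k) (f * g).
Proof.
elim: m f => [|m IH] f If Ig; first by have [_ _ IM] := ideal_pow_ideal I k; apply: IM.
case: If => [l [a [b [Ia Ib ->]]]].
exists l, a, (fun i => b i * g); split=> // [i|]; first exact: IH (Ib i) Ig.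
by rewrite mulr_suml; apply: eq_bigr => i _; rewrite mulrA.
Qed.

Lemma ideal_pow_le I m k : (m <= k)%N -> ideal_pow I k `<=` ideal_pow I m.
Proof.
move=> /subnK <-; elim: (k - m)%N => [//|l IH] f [j [a [b [_ Ib ->]]]].
apply: (ideal_sum (ideal_pow_ideal I m)) => i.
by have [_ _ IM] := ideal_pow_ideal I m; apply: IM; apply: IH; apply: Ib.
Qed.

Lemma prime_notin_neq0 Q s : is_prime Q -> ~ Q s -> tofrac s != 0.
Proof.
by move=> [[Q0 _ _] _ _] nQs; rewrite tofrac_eq0; apply: contra_notN nQs => /eqP ->.
Qed.

Lemma prime_notinM Q s t : is_prime Q -> ~ Q s -> ~ Q t -> ~ Q (s * t).
Proof. by case=> _ _ QP ns nt /QP[]. Qed.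

Lemma symbolic_pow_ideal I m : is_ideal (symbolic_pow I m).
Proof.
have [J0 JD JM] := ideal_pow_ideal I m.
split=> [Q [pQ _]|f g If Ig Q aQ|r f If Q aQ].
- exists 0, 1; split=> //; last by rewrite tofrac0 mul0r.
  by case: pQ.
- have [a [s [Ja Qs fE]]] := If _ aQ; have [b [t [Jb Qt gE]]] := Ig _ aQ.
  have pQ := aQ.1; exists (t * a + s * b), (s * t); split.
  + by apply: JD; apply: JM.
  + exact: prime_notinM.
  have s0 := prime_notin_neq0 pQ Qs; have t0 := prime_notin_neq0 pQ Qt.
  rewrite tofracD fE gE tofracD !tofracM addf_div //.
  by congr (_ / _); congr (_ + _); rewrite mulrC.
- have [a [s [Ja Qs fE]]] := If _ aQ.
  exists (r * a), s; split=> //; first exact: JM.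
  by rewrite !tofracM fE mulrA.
Qed.

Lemma symbolic_powM I m k f g :
  symbolic_pow I m f -> symbolic_pow I k g -> symbolic_pow I (m + k) (f * g).
Proof.
move=> If Ig Q aQ.
have [a [s [Ja Qs fE]]] := If _ aQ; have [b [t [Jb Qt gE]]] := Ig _ aQ.
exists (a * b), (s * t); split; first exact: ideal_powM.
  exact: prime_notinM aQ.1 Qs Qt.
by rewrite !tofracM fE gE mulf_div.
Qed.

Lemma symbolic_powX I m k f :
  symbolic_pow I m f -> symbolic_pow I (m * k) (f ^+ k).
Proof.
move=> If; elim: k => [|k IH]; last by rewrite mulnS exprS; apply: symbolic_powM.
rewrite muln0 expr0 => Q aQ; exists 1, 1; split=> //; first by case: aQ.1.
by rewrite tofrac1 divr1.
Qed.

Lemma symbolic_pow_le I m k : (m <= k)%N -> symbolic_pow I k `<=` symbolic_pow I m.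
Proof.
move=> mk f If Q aQ; have [a [s [Ja Qs fE]]] := If _ aQ.
by exists a, s; split=> //; apply: ideal_pow_le Ja.
Qed.

End SymbolicPowers.

(** Raising to the power [k] maps I^(p) into I^(pk), which lies in I^(m), and multiplies the
    exponents of leading monomials by [k]. *)
Lemma cumulative_hilbert_symbolic (K : fieldType) N (I : set {mpoly K[N]}) m p k T :
  (0 < k)%N -> (m <= p * k)%N ->
  (cumulative_hilbert (symbolic_pow I m) (m * T) <=
     k ^ N * cumulative_hilbert (symbolic_pow I p) (p * T))%N.
Proof.
move=> k0 mpk; apply: cumulative_hilbert_le => //.
- exact: symbolic_pow_ideal.
- by rewrite mulnA leq_mul2r (mulnC k) mpk orbT.
move=> a [f [If hf f0 lf]]; exists (f ^+ k); split.
- exact: symbolic_pow_le mpk _ (symbolic_powX k If).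
- by rewrite mdegMn; apply: dhomogMn.
- by rewrite expf_neq0.
- by rewrite mleadX // lf.
Qed.

(** * Length of minimal free resolutions *)

Section ResolutionLength.
Context {K : fieldType} {N : nat}.
Local Notation S := {mpoly K[N]}.

(* f lies in (x_1, ..., x_k), i.e. these variables occur in all its monomials. *)
Definition in_vars (k : nat) (f : S) : Prop :=
  forall m : 'X_{1..N}, (forall i : 'I_N, (i < k)%N -> m i = 0%N) -> f@_m = 0.

Lemma in_vars0 k : in_vars k 0. Proof. by move=> m _; rewrite mcoeff0. Qed.

Lemma in_varsD k f g : in_vars k f -> in_vars k g -> in_vars k (f + g).
Proof. by move=> kf kg m km; rewrite mcoeffD kf // kg // addr0. Qed.

Lemma in_varsN k f : in_vars k f -> in_vars k (- f).
Proof. by move=> kf m km; rewrite mcoeffN kf // oppr0. Qed.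

Lemma in_varsMr k f g : in_vars k f -> in_vars k (f * g).
Proof.
move=> kf m km; rewrite mcoeffM big1 // => a /eqP ma.
have mE i : m i = (a.1 i + a.2 i)%N by rewrite -mnmDE -ma.
rewrite kf ?mul0r // => i /km /eqP.
by rewrite mE addn_eq0 => /andP[/eqP].
Qed.

Lemma in_varsMl k f g : in_vars k g -> in_vars k (f * g).
Proof. by rewrite mulrC; apply: in_varsMr. Qed.

Lemma in_vars_sum k (I : finType) (F : I -> S) :
  (forall i, in_vars k (F i)) -> in_vars k (\sum_i F i).
Proof.
by move=> kF; elim/big_rec: _ => [|i x _]; [apply: in_vars0 | apply: in_varsD].
Qed.

Lemma in_varsS k f : in_vars k f -> in_vars k.+1 f.
Proof. by move=> kf m km; apply: kf => i /ltnW /km. Qed.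

Lemma in_vars_var (k : 'I_N) : in_vars k.+1 'X_k.
Proof.
move=> m /(_ k (ltnSn k)) mk; rewrite mcoeffX; have [e|//] := eqVneq.
by move: mk; rewrite -e mnm1E eqxx.
Qed.

(** Multiplication by ['X_k] leaves the exponents of the earlier variables alone, so ['X_k] is a
    nonzerodivisor modulo them. *)
Lemma in_vars_cancel (k : 'I_N) f : in_vars k ('X_k * f) -> in_vars k f.
Proof.
move=> kf m km; rewrite -(mcoeffMX f U_(k) m) mulrC kf // => i ik.
by rewrite mnmDE km // mnm1E; case: eqP => // ki; rewrite ki ltnn in ik.
Qed.

Lemma mpoly_divX (k : 'I_N) (f : S) :
  exists g h, f = 'X_k * g + h /\ forall m : 'X_{1..N}, m k != 0%N -> h@_m = 0.
Proof.
elim/mpolyind: f => [|c m p _ _ [g [h [-> hP]]]].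
  by exists 0, 0; rewrite mulr0 addr0; split=> // m _; rewrite mcoeff0.
have [mk|mk] := eqVneq (m k) 0%N.
  exists g, (c *: 'X_[m] + h); split; first by rewrite addrCA.
  move=> m' m'k; rewrite mcoeffD mcoeffZ mcoeffX hP // addr0.
  by case: eqP => [e|_]; [rewrite -e mk in m'k | rewrite mulr0].
exists (c *: 'X_[m - U_(k)] + g), h; split=> //.
rewrite mulrDr addrA -scalerAr -mpolyXD addmC submK //.
apply/mnm_lepP => i; rewrite mnm1E; case: eqP => // <-.
by rewrite lt0n.
Qed.

(** The remainder of the division by ['X_k] is free of ['X_k], so each of its monomials must involve
    an earlier variable. *)
Lemma in_vars_div (k : 'I_N) f : in_vars k.+1 f -> exists g, in_vars k (f - 'X_k * g).
Proof.
move=> kf; have [g [h [e hP]]] := mpoly_divX k f; exists g.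
rewrite e addrC addKr => m km.
have [mk|mk] := eqVneq (m k) 0%N; last exact: hP.
have km' (i : 'I_N) : (i < k.+1)%N -> m i = 0%N.
  rewrite ltnS leq_eqVlt => /predU1P[/val_inj -> //|]; exact: km.
have -> : h = f - 'X_k * g by rewrite e addrC addKr.
by rewrite mcoeffB kf // (in_varsMr _ (in_vars_var (k := k))) // subr0.
Qed.

Definition in_varsv k r (u : 'rV[S]_r) : Prop := forall j, in_vars k (u 0 j).

Lemma in_varsv_mul k r r' (u : 'rV[S]_r) (D : 'M_(r, r')) :
  in_varsv k u -> in_varsv k (u *m D).
Proof. by move=> ku j; rewrite mxE; apply: in_vars_sum => i; apply: in_varsMr. Qed.

Lemma in_varsvD k r (u v : 'rV[S]_r) :
  in_varsv k u -> in_varsv k v -> in_varsv k (u + v).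
Proof. by move=> ku kv j; rewrite mxE; apply: in_varsD. Qed.

Lemma in_varsvZ k r a (u : 'rV[S]_r) : in_varsv k u -> in_varsv k (a *: u).
Proof. by move=> ku j; rewrite mxE; apply: in_varsMl. Qed.

Lemma in_varsvN k r (u : 'rV[S]_r) : in_varsv k u -> in_varsv k (- u).
Proof. by move=> ku j; rewrite mxE; apply: in_varsN. Qed.

Context {J : set S} (F : min_free_resolution J).

(* F/(x_1, ..., x_k)F is exact in homological degrees > k: each x_(k+1) is
   regular modulo the previous variables, and killing it costs one degree. *)
Lemma exact_mod_vars k : (k <= N)%N -> forall i, (k <= i)%N ->
  forall u : 'rV_(rk F i.+1), in_varsv k (u *m dif F i) ->
  exists v, in_varsv k (u - v *m dif F i.+1).
Proof.
elim: k => [_ i _ u ku|k IH kN [//|i] ki u ku].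
  have /exact_dif[v ->] : u *m dif F i = 0.
    by apply/rowP => j; rewrite [RHS]mxE; apply/mpolyP => m; rewrite mcoeff0 ku.
  by exists v => j; rewrite subrr mxE; apply: in_vars0.
pose x : S := 'X_(Ordinal kN).
have [w wP] : exists w : 'rV_(rk F i.+1), in_varsv k (u *m dif F i.+1 - x *: w).
  have ex j : exists g, in_vars k ((u *m dif F i.+1) 0 j - x * g).
    exact: (in_vars_div (k := Ordinal kN) (ku j)).
  have [g gP] := choice ex; exists (\row_j g j) => j.
  by have := gP j; rewrite !mxE.
have kw : in_varsv k (w *m dif F i).
  have : in_varsv k ((u *m dif F i.+1 - x *: w) *m dif F i) by apply: in_varsv_mul.
  have -> : (u *m dif F i.+1 - x *: w) *m dif F i = - (x *: (w *m dif F i)).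
    rewrite mulmxBl -scalemxAl; have -> : u *m dif F i.+1 *m dif F i = 0.
      by apply/exact_dif; exists u.
    by rewrite sub0r.
  move/in_varsvN; rewrite opprK => kxw j.
  by apply: (in_vars_cancel (k := Ordinal kN)); have := kxw j; rewrite mxE.
(* Modulo the first [k] variables [w] is a cycle, hence the boundary of some [v]. Then [u - x *: v]
   is a cycle modulo them, thus a boundary too, and so [u] is a boundary once [x] is also killed. *)
have [v vP] := IH (ltnW kN) i ki w kw.
have [|v' v'P] := IH (ltnW kN) i.+1 (leqW ki) (u - x *: v).
  have := in_varsvD wP (in_varsvZ x vP).
  by rewrite scalerBr addrA subrK mulmxBl -scalemxAl.
exists v' => j; have /in_varsS := v'P j.
have := in_varsMr (v 0 j) (in_vars_var (k := Ordinal kN)).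
move=> /in_varsD h /h; congr in_vars; rewrite !mxE -/x.
by ring.
Qed.

(** Modulo all [N] variables the differentials vanish by minimality, yet exactness persists in
    degrees above [N]. A basis vector there would then lie in the ideal of the variables, which its
    entry 1 does not. *)
Lemma rk_eq0 i : (N < i)%N -> rk F i = 0%N.
Proof.
case: i => // i; rewrite ltnS => Ni; case r0 : (rk F i.+1) => [//|r].
have j : 'I_(rk F i.+1) by rewrite r0; exact: ord0.
have in0 (f : S) : f@_0 = 0 -> in_vars N f.
  move=> f0 m m0; suff -> : m = 0%MM by [].
  by apply/mnmP => l; rewrite mnm0E m0.
have mulN i' (u : 'rV_(rk F i'.+1)) : in_varsv N (u *m dif F i').
  by move=> l; rewrite mxE; apply: in_vars_sum => k; apply/in_varsMl/in0/minimality.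
have [v] := exact_mod_vars (leqnn N) Ni (mulN _ (delta_mx 0 j)).
move/in_varsvD => /(_ _ (mulN _ v)); rewrite subrK => /(_ j 0%MM).
rewrite mxE !eqxx mcoeff1 eqxx => /(_ (fun i _ => mnm0E i)) /eqP.
by rewrite oner_eq0.
Qed.

End ResolutionLength.

(** * Hilbert functions from resolutions *)

Lemma dependent_fun_choice (X : Type) (Y : X -> Type) (P : forall x, Y x -> Prop) :
  (forall x, exists y, P x y) -> exists f : forall x, Y x, forall x, P x (f x).
Proof. by move=> h; exists (fun x => projT1 (cid (h x))) => x; apply: projT2 (cid (h x)). Qed.

Section HilbertPolynomial.
Context {K : fieldType}.

Lemma has_dim0 (V : lmodType K) (W : set V) : W `<=` [set 0] -> has_dim W [set 0] 0.
Proof.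
move=> W0; exists (fun=> 0); split=> [[]//|f /W0 /= ->]; exists 0.
by split=> [|c _]; [rewrite big_ord0 subrr | apply/rowP; case].
Qed.

Lemma has_dim_ffun (V : lmodType K) r (W : 'I_r -> set V) (d : 'I_r -> nat) :
  (forall j, subspace (W j)) -> (forall j, has_dim (W j) [set 0] (d j)) ->
  has_dim [set f : {ffun 'I_r -> V} | forall j, W j (f j)] [set 0] (\sum_j d j).
Proof.
move=> sW hd.
have {}hd j : exists b : 'I_(d j) -> V, (forall i, W j (b i)) /\
    forall f, W j f -> exists! c : 'rV[K]_(d j), [set 0] (f - comb b c) := hd j.
have [b bP] := dependent_fun_choice hd.
pose I : finType := {j : 'I_r & 'I_(d j)}.
pose B (p : I) : {ffun 'I_r -> V} := [ffun j => if j == tag p then b _ (tagged p) else 0].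
have -> : (\sum_j d j = #|I|)%N.
  rewrite card_tagged sumnE big_map big_enum /=.
  by apply: eq_bigr => j _; rewrite card_ord.
have sumB (c : I -> K) j :
    (\sum_p c p *: B p) j = comb (b j) (\row_i c (Tagged (fun j => 'I_(d j)) i)).
  rewrite sum_ffunE /comb.
  have -> : \sum_p (c p *: B p) j = \sum_k \sum_(i < d k)
      (c (Tagged (fun j => 'I_(d j)) i) *: B (Tagged (fun j => 'I_(d j)) i)) j.
    by rewrite (sig_big_dep xpredT (fun=> xpredT)) /=; apply: eq_bigr => -[].
  rewrite (bigD1 j) //=.
  rewrite [X in _ + X]big1 ?addr0 => [|k kj].
    by apply: eq_bigr => i _; rewrite !ffunE eqxx mxE.
  by rewrite big1 // => i _; rewrite !ffunE eq_sym (negbTE kj) scaler0.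
apply: (has_dim_fin (b := B)) => [|p j|f Wf|c c0 [j i]].
- exact: subspace0.
- rewrite ffunE; have [->|_] := eqVneq; last exact: (sW j).1.
  exact: (bP _).1.
- have exc j : exists c : 'rV[K]_(d j), f j = comb (b j) c.
    by have [c [/eqP]] := (bP j).2 _ (Wf j); rewrite subr_eq0 => /eqP; exists c.
  have [c cP] := dependent_fun_choice exc.
  exists (fun p => c (tag p) 0 (tagged p)); apply/eqP; rewrite subr_eq0; apply/eqP.
  apply/ffunP => j; rewrite sumB cP; congr comb.
  by apply/rowP => i; rewrite mxE.
- have [x [_ xu]] := (bP j).2 _ (sW j).1.
  have e0 : x = 0 by apply: xu; rewrite /= comb0 subrr.
  have : x = \row_i c (Tagged (fun j => 'I_(d j)) i).
    by apply: xu; rewrite /= -sumB c0 ffunE subrr.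
  by rewrite e0 => /rowP/(_ i); rewrite !mxE => <-.
Qed.

Lemma card_mdeg n e :
  #|[pred a : 'X_{1..n.+1 < e.+1} | mdeg a == e]| = 'C(e + n, n).
Proof.
rewrite -bin_sub ?leq_addl // addnK -size_basis cardE.
rewrite -(size_map (@bmnm _ _)); apply/perm_size/uniq_perm.
- by rewrite map_inj_uniq ?enum_uniq //; apply: val_inj.
- exact: uniq_basis.
move=> m; rewrite -basis_cover; apply/mapP/idP => [[a]|/eqP me].
  by rewrite mem_enum inE => ? ->.
have me' : (mdeg m < e.+1)%N by rewrite me.
by exists (BMultinom me') => //; rewrite mem_enum inE /= me.
Qed.

(** For the zero ideal every monomial is standard. *)
Lemma has_dim_homog n e :
  has_dim [set f : {mpoly K[n.+1]} | f \is e.-homog] [set 0] 'C(e + n, n).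
Proof.
have i0 : is_ideal [set 0 : {mpoly K[n.+1]}].
  by split=> [//|f g /= -> ->|r f /= ->]; rewrite ?addr0 ?mulr0.
rewrite -card_mdeg; have := has_dim_standard i0 (ltnSn e); congr has_dim.
apply: eq_card => a; rewrite !inE; case: eqP => //= _; apply/negP => /asboolP.
by case=> f [-> _ /eqP].
Qed.

Lemma binomial_polynomial (R : realType) n : exists p : {poly R},
  (size p <= n.+1)%N /\ forall e, 'C(e + n, n)%:R = p.[e%:R].
Proof.
elim: n => [|n [p [sp pE]]].
  by exists 1; rewrite size_poly1; split=> // e; rewrite bin0 hornerE.
(* From (n+1) C(e+n+1, n+1) = (e+n+1) C(e+n, n). *)
exists (n.+1%:R^-1 *: (('X + n.+1%:R%:P) * p)); split=> [|e].
  apply: leq_trans (size_scale_leq _ _) _.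
  apply: leq_trans (size_polyMleq _ _) _.
  by rewrite size_XaddC.
rewrite hornerZ hornerM hornerD hornerX hornerC -pE -natrD -natrM addnS.
have /(congr1 (fun k => k%:R : R)) := mul_bin_diag (e + n).+1 n.
rewrite /= => ->; rewrite natrM mulKf // pnatr_eq0.
Qed.

Lemma mcoeff_pihomog N d (f : {mpoly K[N]}) m :
  (pihomog mdeg d f)@_m = if mdeg m == d then f@_m else 0.
Proof.
pose k := maxn (msize f) (mdeg m).+1.
rewrite (pihomogwE _ _ (leq_maxl _ (mdeg m).+1)) -/k.
rewrite -[RHS](mcoeff_mpoly (fun m => if mdeg m == d then f@_m else 0) (k := k)).
  rewrite big_mkcond; congr mcoeff; apply: eq_bigr => a _.
  by case: eqP => //; rewrite scale0r.
by rewrite leq_max ltnSn orbT.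
Qed.

(** Here [g] stands for an entry of a differential. The identity lets an arbitrary preimage under a
    matrix of forms be replaced by its component in the right degree. *)
Lemma pihomogM N e e' (f g : {mpoly K[N]}) :
  (forall m, m \in msupp g -> (e + mdeg m)%N = e') ->
  pihomog mdeg e' (f * g) = pihomog mdeg e f * g.
Proof.
move=> gP; apply/mpolyP => m.
have termE (a b : 'X_{1..N}) : m = (a + b)%MM ->
    (pihomog mdeg e f)@_a * g@_b = (mdeg m == e')%:R * (f@_a * g@_b).
  move=> ->; have [->|g0] := eqVneq g@_b 0; first by rewrite !mulr0.
  have {gP} := gP b; rewrite mcoeff_msupp => /(_ g0) <-.
  by rewrite mdegD eqn_add2r mcoeff_pihomog; case: eqP; rewrite ?(mul1r, mul0r).
rewrite mcoeff_pihomog [RHS]mcoeffM [X in if _ then X else _]mcoeffM.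
transitivity ((mdeg m == e')%:R *
  \sum_(a : 'X_{1..N < (mdeg m).+1, (mdeg m).+1} | m == (a.1 + a.2)%MM)
     (f@_a.1 * g@_a.2)).
  by case: eqP; rewrite (mul1r, mul0r).
by rewrite big_distrr /=; apply: eq_bigr => a /eqP ma; rewrite termE.
Qed.

(** * Strands of a resolution in a fixed degree *)

Section Resolution.
Context {n : nat} {J : set {mpoly K[n.+1]}} (F : min_free_resolution J).
Local Notation S := {mpoly K[n.+1]}.

(** Dimensions over [K] need a [K]-vector space: finite functions into [S] form one, whereas row
    vectors over [S] are a module over [S]. Hence this second version of the matrix product. *)
Definition dotv r (a : 'cV[S]_r) (f : {ffun 'I_r -> S}) : S := \sum_k f k * a k 0.

Definition ffun_mul r r' (D : 'M[S]_(r, r')) (f : {ffun 'I_r -> S}) : {ffun 'I_r' -> S} :=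
  [ffun j => dotv (col j D) f].

Lemma dotvP r (a : 'cV[S]_r) c u v : dotv a (c *: u + v) = c *: dotv a u + dotv a v.
Proof.
rewrite /dotv scaler_sumr -big_split /=; apply: eq_bigr => i _.
by rewrite !ffunE mulrDl scalerAl.
Qed.

Lemma ffun_mulP r r' (D : 'M[S]_(r, r')) c u v :
  ffun_mul D (c *: u + v) = c *: ffun_mul D u + ffun_mul D v.
Proof. by apply/ffunP => j; rewrite !ffunE dotvP. Qed.

Lemma ffun_row r (f : {ffun 'I_r -> S}) : [ffun k => (\row_j f j) 0 k] = f.
Proof. by apply/ffunP => k; rewrite ffunE mxE. Qed.

Lemma mulmx_dotv r (a : 'cV[S]_r) (u : 'rV_r) :
  (u *m a) 0 0 = dotv a [ffun k => u 0 k].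
Proof. by rewrite mxE; apply: eq_bigr => k _; rewrite ffunE. Qed.

Lemma mulmx_ffun_mul r r' (D : 'M[S]_(r, r')) (u : 'rV_r) :
  u *m D = \row_j ffun_mul D [ffun k => u 0 k] j.
Proof.
by apply/rowP => j; rewrite !mxE ffunE; apply: eq_bigr => k _; rewrite ffunE mxE.
Qed.

(* The degree s part of F_i, provided that its shifts are at most s (the absolute
   value gives junk otherwise). *)
Definition graded_part (s : nat) i : set {ffun 'I_(rk F i) -> S} :=
  [set f | forall j, f j \is `|s%:Z - sh j|%N.-homog].

Definition graded_cycles (s : nat) i : set {ffun 'I_(rk F i) -> S} :=
  match i with
  | 0%N => [set f | graded_part s f /\ dotv (aug F) f = 0]
  | i'.+1 => [set f | graded_part s f /\ ffun_mul (dif F i') f = 0]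
  end.

Lemma graded_part_subspace s i : subspace (@graded_part s i).
Proof.
split=> [j|a u v hu hv j] /=; first by rewrite ffunE rpred0.
by rewrite !ffunE rpredD ?rpredZ.
Qed.

Lemma has_dim_graded_part s i :
  has_dim (@graded_part s i) [set 0] (\sum_(j < rk F i) 'C(`|s%:Z - sh j|%N + n, n)).
Proof.
apply: (has_dim_ffun (W := fun j => [set f | f \is `|s%:Z - sh j|%N.-homog])) => j.
  exact: homog_subspace.
exact: has_dim_homog.
Qed.

Section Shifts.
Variable s : nat.
Hypothesis shs : forall i (j : 'I_(rk F i)), sh j <= s%:Z.

(** Exactness restricts to the strand of degree [s]: a preimage of a cycle is projected entrywise to
    the degrees s - sh, which keeps its image since the entries of the differential are homogeneous.
    By [shs] the absolute values are true differences. *)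
Lemma image_dif i :
  ffun_mul (dif F i) @` @graded_part s i.+1 = @graded_cycles s i.
Proof.
have degE k j m : m \in msupp (dif F i k j) ->
    (`|s%:Z - sh k| + mdeg m)%N = `|s%:Z - sh j|%N.
  by move/dif_homog; have := shs k; have := shs j; lia.
apply/seteqP; split=> [_ [f hf <-]|f].
  have hL : graded_part s (ffun_mul (dif F i) f).
    move=> j; rewrite ffunE; apply: rpred_sum => k _; rewrite mxE.
    rewrite -[f k](pihomog_dE (d := `|s%:Z - sh k|%N) (mf := mdeg)) //.
    by rewrite -(pihomogM _ (@degE k j)) pihomogP.
  have f0 : \row_j ffun_mul (dif F i) f j = (\row_k f k) *m dif F i.
    by rewrite mulmx_ffun_mul ffun_row.
  case: i {degE} f hf hL f0 => [|i] f hf hL f0; split=> //.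
    have : (\row_j ffun_mul (dif F 0) f j) *m aug F = 0.
      by apply/exact_aug; exists (\row_k f k).
    by move=> /matrixP/(_ 0 0); rewrite mulmx_dotv ffun_row mxE.
  have : (\row_j ffun_mul (dif F i.+1) f j) *m dif F i = 0.
    by apply/exact_dif; exists (\row_k f k).
  rewrite mulmx_ffun_mul ffun_row => /rowP e0; apply/ffunP => j.
  by have := e0 j; rewrite !mxE => ->; rewrite ffunE.
move=> fZ.
have [hf [v fv]] : graded_part s f /\ exists v, \row_k f k = v *m dif F i.
  case: i f fZ {degE} => [|i] f [hf f0]; split=> //.
    apply/exact_aug; apply/matrixP => a b.
    by rewrite !ord1 mulmx_dotv ffun_row f0 mxE.
  apply/exact_dif; rewrite mulmx_ffun_mul ffun_row f0; apply/rowP => j.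
  by rewrite !mxE ffunE.
exists [ffun k => pihomog mdeg `|s%:Z - sh k|%N (v 0 k)].
  by move=> k; rewrite ffunE; apply: pihomogP.
apply/ffunP => j; rewrite ffunE /dotv.
rewrite -[RHS](pihomog_dE (hf j)).
have -> : f j = \sum_k v 0 k * dif F i k j.
  by move/rowP/(_ j): fv; rewrite !mxE.
rewrite raddf_sum; apply: eq_bigr => k _ /=.
by rewrite ffunE mxE (pihomogM _ (@degE k j)).
Qed.

Lemma image_aug :
  dotv (aug F) @` @graded_part s 0 = [set f | J f /\ f \is s.-homog].
Proof.
have degE k m : m \in msupp (aug F k 0) -> (`|s%:Z - sh k| + mdeg m)%N = s.
  by move/aug_homog; have := shs k; lia.
apply/seteqP; split=> [_ [f hf <-]|f [Jf hf]].
  split.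
    apply/(aug_image F); by exists (\row_k f k); rewrite mulmx_dotv ffun_row.
  apply: rpred_sum => k _.
  rewrite -[f k](pihomog_dE (d := `|s%:Z - sh k|%N) (mf := mdeg)) //.
  by rewrite -(pihomogM _ (@degE k)) pihomogP.
have [v fv] := (aug_image F f).1 Jf.
exists [ffun k => pihomog mdeg `|s%:Z - sh k|%N (v 0 k)].
  by move=> k; rewrite ffunE; apply: pihomogP.
rewrite -[RHS](pihomog_dE hf) fv mxE raddf_sum; apply: eq_bigr => k _ /=.
by rewrite ffunE (pihomogM _ (@degE k)).
Qed.

End Shifts.

Lemma graded_part_polynomial (R : realType) i : exists p : {poly R},
  (size p <= n.+1)%N /\ forall s, (forall j : 'I_(rk F i), sh j <= s%:Z) ->
    (\sum_(j < rk F i) 'C(`|s%:Z - sh j|%N + n, n))%:R = p.[s%:R].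
Proof.
have [b [sb bE]] := binomial_polynomial R n.
exists (\sum_(j < rk F i) (b \Po ('X - (sh j)%:~R%:P))); split=> [|s shs].
  apply: leq_trans (size_sum _ _ _) _; apply/bigmax_leqP => j _.
  rewrite size_comp_poly2 //; exact: size_XsubC.
rewrite horner_sum natr_sum; apply: eq_bigr => j _.
rewrite horner_comp hornerD hornerN hornerX hornerC bE; congr (b.[_]).
have -> : s%:R = s%:~R :> R by [].
by rewrite -intrB -[LHS]/((`|s%:Z - sh j|%N)%:~R) gez0_abs // subr_ge0.
Qed.

(** Descending induction from [len F], where the cycles vanish. The cycles of F_i are the image of
    F_(i+1), so rank-nullity gives their dimension as that of F_(i+1) minus that of its cycles. *)
Lemma graded_cycles_polynomial (R : realType) l i : (len F <= i + l)%N ->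
  exists p : {poly R}, (size p <= n.+1)%N /\
    forall s, (forall i (j : 'I_(rk F i)), sh j <= s%:Z) ->
      exists z, has_dim (@graded_cycles s i) [set 0] z /\ z%:R = p.[s%:R].
Proof.
elim: l i => [|l IH] i il.
  rewrite addn0 in il; exists 0; rewrite size_poly0; split=> // s _; exists 0%N.
  split; last by rewrite horner0.
  apply: has_dim0 => f _; apply/ffunP => j.
  by have := ltn_ord j; rewrite [X in (_ < X)%N](rk_len il).
have [|p [sp pP]] := IH i.+1; first by rewrite addSnnS.
have [q [sq qP]] := graded_part_polynomial R i.+1.
exists (q - p); split=> [|s shs].
  by apply: leq_trans (size_polyD _ _) _; rewrite size_polyN geq_max sq.
have [z [hz zE]] := pP s shs.
have := has_dim_image (graded_part_subspace s i.+1) (ffun_mulP (dif F i))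
  (has_dim_graded_part s i.+1).
move=> [e [g [he hg eg]]]; exists g; split; first by rewrite -(image_dif shs).
rewrite hornerD hornerN -qP // -zE eg natrD.
by rewrite (has_dim_uniq (subspace0 _) he hz) addrAC subrr add0r.
Qed.

(** In degree s, dim S/J = dim S - dim F_0 + dim of the cycles of F_0, because F_0 maps onto J. *)
Lemma hilbert_function_resolution (R : realType) : is_ideal J ->
  exists p : {poly R}, (size p <= n.+1)%N /\
    forall s, (forall i (j : 'I_(rk F i)), sh j <= s%:Z) ->
      (hilbert_function J s)%:R = p.[s%:R].
Proof.
move=> iJ; have [b [sb bE]] := binomial_polynomial R n.
have [p [sp pP]] := graded_cycles_polynomial R (leqnn (len F) : (len F <= 0 + len F)%N).
have [q [sq qP]] := graded_part_polynomial R 0.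
exists (b - q + p); split=> [|s shs].
  do 2 (apply: leq_trans (size_polyD _ _) _; rewrite geq_max ?size_polyN ?sp ?sq ?andbT).
  exact: sb.
have [z [hz zE]] := pP s shs.
have := has_dim_image (graded_part_subspace s 0) (dotvP (aug F)) (has_dim_graded_part s 0).
rewrite (image_aug shs) => -[e [g [he hg eg]]].
have sJ := ideal_subspace iJ.
have sJs : subspace [set f | J f /\ f \is s.-homog].
  split=> [|a u v [Ju hu] [Jv hv]]; first by split; [exact: sJ.1 | rewrite rpred0].
  by split; [exact: sJ.2 | rewrite rpredD ?rpredZ].
have := has_dim_split (homog_subspace s) sJs (fun f => @proj2 _ _) (has_dim_homog n s).
move=> [g' [h [hg' [v [hv vP]] gh]]].
have hJ : has_dim [set f | f \is s.-homog] J h.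
  exists v; split=> // f hf; have [c [[Jc _] cu]] := vP f hf.
  exists c; split=> // c' Jc'; apply: cu; split=> //.
  by rewrite rpredB // rpred_sum // => i _; rewrite rpredZ //; apply: hv.
rewrite (hilbert_functionP iJ hJ) !hornerD hornerN -bE -qP // -zE gh eg.
rewrite (has_dim_uniq (subspace0 _) he hz) (has_dim_uniq (subspace0 _) hg' hg).
by rewrite !natrD; ring.
Qed.

End Resolution.

End HilbertPolynomial.

(** * Limits *)

Section Limits.
Context {R : realType}.

Lemma cvg_inv_nat : (fun m => m%:R^-1 : R) @ \oo --> (0 : R).
Proof. by rewrite -cvg_shiftS; apply: cvg_harmonic. Qed.

Lemma cvg_horner (p : {poly R}) (u : R^nat) (l : R) :
  u @ \oo --> l -> (fun m => p.[u m]) @ \oo --> p.[l].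
Proof.
move=> ul; elim/poly_ind: p => [|p c IH].
  by under eq_fun do rewrite horner0; rewrite horner0; apply: cvg_cst.
under eq_fun do rewrite hornerMXaddC; rewrite hornerMXaddC.
exact: cvgD (cvgM IH ul) (cvg_cst _).
Qed.

Lemma cvg_horner_diff (p : {poly R}) (t : R) :
  (fun m => m%:R * (p.[t] - p.[t - m%:R^-1])) @ \oo --> p^`().[t].
Proof.
have th : (fun m => t - m%:R^-1) @ \oo --> t.
  by rewrite -[X in _ --> X]subr0; apply: cvgB; [apply: cvg_cst | apply: cvg_inv_nat].
elim/poly_ind: p => [|p c IH].
  under eq_fun do rewrite !horner0 subrr mulr0.
  by rewrite deriv0 horner0; apply: cvg_cst.
have -> : (p * 'X + c%:P)^`().[t] = p^`().[t] * t + p.[t].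
  by rewrite derivD derivC addr0 derivM derivX mulr1 hornerD hornerMX.
apply: (cvg_trans _ (cvgD (cvgM IH (cvg_cst t)) (cvg_horner (p := p) th))).
apply: near_eq_cvg; near=> m.
have m0 : m%:R != 0 :> R by rewrite pnatr_eq0 -lt0n; near: m; apply: nbhs_infty_ge.
rewrite /= !hornerMXaddC.
have -> : m%:R * (p.[t] * t + c - (p.[t - m%:R^-1] * (t - m%:R^-1) + c)) =
  m%:R * (p.[t] - p.[t - m%:R^-1]) * t + p.[t - m%:R^-1] * (m%:R * m%:R^-1) by ring.
by rewrite mulfV // mulr1.
Unshelve. all: by end_near. Qed.

(** As in Fekete's lemma, the limit is the infimum of c(p) / p^N over p > 0. For p nearly attaining
    it and k = floor(m/p) + 1, one has kp <= m + p, so c(m) / m^N <= (1 + p/m)^N c(p) / p^N. *)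
Lemma cvg_subhomogeneous N (c : nat -> nat) :
  (forall m p k, (0 < p)%N -> (0 < k)%N -> (m <= p * k)%N -> (c m <= k ^ N * c p)%N) ->
  cvgn (fun m => (c m)%:R / m%:R ^+ N : R).
Proof.
move=> cP; pose f m : R := (c m)%:R / m%:R ^+ N.
have f0 m : 0 <= f m by rewrite /f divr_ge0 // exprn_ge0.
pose E := [set f p | p in [set p | (0 < p)%N]].
have hE : has_inf E by split; [exists (f 1), 1 | exists 0 => _ [p _ <-]].
apply/cvg_ex; exists (inf E); apply/cvgrPdist_lt => e e0.
have [_ [p p0 <-] fpe] := inf_adherent e0 hE.
(* This upper bound, as a polynomial in 1/m; its value at 0 is [f p]. *)
pose q : {poly R} := f p *: (1 + p%:R *: 'X) ^+ N.
have := cvg_horner (p := q) cvg_inv_nat.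
rewrite [q.[0]]hornerZ horner_exp hornerD hornerZ hornerX mulr0 hornerC addr0 expr1n mulr1.
move=> /cvgr_lt/(_ _ fpe) qlt; near=> m.
have m0 : (0 < m)%N by near: m; apply: nbhs_infty_ge.
have m0' : 0 < m%:R :> R by rewrite ltr0n.
have p0' : 0 < p%:R :> R by rewrite ltr0n.
have Lm : inf E <= f m by apply: ge_inf; [case: hE | exists m].
rewrite distrC ger0_norm ?subr_ge0 // ltrBlDl.
apply: (@le_lt_trans _ _ q.[m%:R^-1]); last by near: m.
rewrite hornerZ horner_exp hornerD hornerZ hornerX hornerC.
pose k := (m %/ p).+1.
have mk : (m <= p * k)%N by rewrite mulnC ltnW // ltn_ceil.
have kR : k%:R * p%:R <= m%:R + p%:R :> R.
  by rewrite -natrM -natrD ler_nat mulSn addnC leq_add2r leq_divM.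
have ck : (c m)%:R <= k%:R ^+ N * (c p)%:R :> R.
  by rewrite -natrX -natrM ler_nat; apply: cP.
rewrite /f ler_pdivrMr ?exprn_gt0 //; apply: (le_trans ck).
have e1 : (1 + p%:R / m%:R) * m%:R = m%:R + p%:R :> R.
  by rewrite mulrDl mul1r mulfVK // gt_eqF.
rewrite -mulrA -exprMn e1 mulrAC ler_pdivlMr ?exprn_gt0 // mulrAC -exprMn mulrC.
by rewrite ler_wpM2l // lerXn2r ?nnegrE ?addr_ge0 ?mulr_ge0.
Unshelve. all: by end_near. Qed.

Lemma lagrange_interpolation D (x : nat -> R) : injective x ->
  exists l : 'I_D -> {poly R},
    forall p : {poly R}, (size p <= D)%N -> p = \sum_(i < D) p.[x i] *: l i.
Proof.
move=> xI; case: D => [|D].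
  by exists (fun=> 0) => p; rewrite leqn0 size_poly_eq0 big_ord0 => /eqP.
exists (fun i => tnth (qpoly.lagrange D.+1 x) i : {poly R}) => p sp.
rewrite {1}(qpoly.lagrange_gen (ltn0Sn D) xI sp).
by apply: eq_bigr => i _; rewrite mul_polyC.
Qed.

(** Interpolation at [D] fixed nodes writes every [r m] in fixed polynomials [l i] with coefficients
    its values at the nodes. These converge, and the difference quotients of [l i] tend to its
    derivative. *)
Lemma cvg_interpolated_diff D (x : nat -> R) (r : nat -> {poly R}) :
  injective x -> (forall m, (size (r m) <= D)%N) ->
  (forall i, cvgn (fun m => (r m).[x i])) ->
  exists q : {poly R}, forall t,
    (fun m => m%:R * ((r m).[t] - (r m).[t - m%:R^-1])) @ \oo --> q.[t].
Proof.
move=> xI sr rx; have [l lP] := lagrange_interpolation D xI.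
exists (\sum_(i < D) limn (fun m => (r m).[x i]) *: (l i)^`()) => t.
rewrite horner_sum; under [X in _ --> X]eq_bigr do rewrite hornerZ.
have -> : (fun m => m%:R * ((r m).[t] - (r m).[t - m%:R^-1])) =
  (fun m => \sum_(i < D) (r m).[x i] * (m%:R * ((l i).[t] - (l i).[t - m%:R^-1]))).
  apply/funext => m; rewrite {1 2}(lP _ (sr m)) !horner_sum -sumrB mulr_sumr.
  by apply: eq_bigr => i _; rewrite !hornerZ; ring.
apply: cvg_big => [|i _]; first exact: add_continuous.
apply: cvgM; [exact: rx | exact: cvg_horner_diff].
Qed.

(** The backward difference of X^(d+1) has degree d and leading coefficient d+1, so a multiple of it
    removes the coefficient of X^d and lowers the size bound. *)
Lemma antidifference d (p : {poly R}) : (size p <= d)%N ->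
  exists q : {poly R}, (size q <= d.+1)%N /\ forall x, q.[x] - q.[x - 1] = p.[x].
Proof.
elim: d p => [|d IH] p.
  rewrite leqn0 size_poly_eq0 => /eqP ->; exists 0; rewrite size_poly0.
  by split=> // x; rewrite !horner0 subrr.
move=> sp; pose r : {poly R} := 'X ^+ d.+1 - ('X - 1%:P) ^+ d.+1.
have mr (i : 'I_d.+1) : 'X^(d - i) * ('X - 1%:P) ^+ i \is @monic R.
  by rewrite rpredM ?monicXn // rpredX // monicXsubC.
have sr (i : 'I_d.+1) : size ('X^(d - i) * ('X - 1%:P) ^+ i : {poly R}) = d.+1.
  rewrite size_Mmonic ?monic_neq0 ?monicXn ?rpredX ?monicXsubC //.
  by rewrite size_polyXn size_exp_XsubC addnS /= addSn subnK // -ltnS.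
have rE : r = \sum_(i < d.+1) 'X^(d - i) * ('X - 1%:P) ^+ i.
  by rewrite /r subrXX opprB addrC subrK mul1r.
have rd : r`_d = d.+1%:R.
  rewrite rE coef_sum (eq_bigr (fun=> 1)) => [|i _].
    by rewrite sumr_const card_ord.
  by have /monicP := mr i; rewrite lead_coefE sr.
have r1 : (size r <= d.+1)%N.
  by rewrite rE; apply: leq_trans (size_sum _ _ _) _; apply/bigmax_leqP => i _; rewrite sr.
pose c := p`_d / d.+1%:R.
have [|q [sq qP]] := IH (p - c *: r).
  apply/leq_sizeP => j; rewrite leq_eqVlt => /predU1P[<-|dj].
    by rewrite coefB coefZ rd /c mulfVK ?pnatr_eq0 // subrr.
  by rewrite coefB coefZ !nth_default ?mulr0 ?subrr // (leq_trans _ dj).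
exists (q + c *: 'X ^+ d.+1); split=> [|x].
  apply: leq_trans (size_polyD _ _) _; rewrite geq_max (leq_trans sq) //=.
  by apply: leq_trans (size_scale_leq _ _) _; rewrite size_polyXn.
have := qP x; rewrite !(hornerD, hornerN, hornerZ, horner_exp, hornerX, hornerC) => e.
rewrite -[RHS](subrK (c * (x ^+ d.+1 - (x - 1) ^+ d.+1))) -e; ring.
Qed.

End Limits.

(** * Asymptotic Hilbert polynomials *)

(** A finite bound rules out the default value +oo, so a resolution exists. Its shifts in step i are
    at most x + i, and i <= [N] by [rk_eq0]. *)
Lemma regularity_resolution (R : realType) (K : fieldType) N (J : set {mpoly K[N]}) (x : R) :
  (er_map (fun z : int => z%:~R) (regularity J) <= x%:E)%E ->
  exists F : min_free_resolution J,
    forall i (j : 'I_(rk F i)), (sh j)%:~R <= x + N%:R.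
Proof.
have [[y Fy]|noF] := pselect (exists y, range (@resolution_reg K N J) y); last first.
  by rewrite /regularity xgetPN // => y Fy; apply: noF; exists y.
have [F _ <-] : range (@resolution_reg K N J) (regularity J).
  by apply: xgetPex; exists y.
move=> regx; exists F => i j.
have iN : (i <= N)%N.
  by rewrite leqNgt; apply/negP => /(rk_eq0 F) r0; have := ltn_ord j; rewrite [X in (_ < X)%N]r0.
have il : (i < len F)%N.
  by rewrite ltnNge; apply/negP => /rk_len r0; have := ltn_ord j; rewrite [X in (_ < X)%N]r0.
have : ((sh j - i%:Z)%:E <= resolution_reg F)%E.
  apply: (@le_trans _ _ (\big[maxe/-oo%E]_(k < rk F i) (sh k - i%:Z)%:E)%E).
    exact: (@le_bigmax _ _ _ -oo%E (fun k : 'I_(rk F i) => (sh k - i%:Z)%:E)).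
  exact: (@le_bigmax _ _ _ -oo%E (fun i : 'I_(len F) =>
    \big[maxe/-oo%E]_(k < rk F i) (sh k - i%:Z)%:E) (Ordinal il)).
move: regx; case: (resolution_reg F) => //= r; rewrite !lee_fin => rx shr.
have : (sh j - i%:Z)%:~R <= r%:~R :> R by rewrite ler_int.
rewrite intrB => h; have iNR : i%:R <= N%:R :> R by rewrite ler_nat.
have -> : (sh j)%:~R = (sh j)%:~R - (i%:Z)%:~R + i%:R :> R by rewrite subrK.
by rewrite lerD // (le_trans h).
Qed.

Lemma poly_eq_large_nat (R : realType) (p q : {poly R}) s0 :
  (forall s, (s0 <= s)%N -> p.[s%:R] = q.[s%:R]) -> p = q.
Proof.
move=> pq; apply/eqP; rewrite -subr_eq0.
apply: contraT => nz.
pose rs : seq R := [seq (s0 + i)%:R | i <- iota 0 (size (p - q))].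
have : (size rs < size (p - q)%R)%N.
  apply: max_poly_roots nz _ _.
    apply/allP => _ /mapP[i _ ->]; rewrite /root hornerD hornerN pq ?leq_addr //.
    by rewrite subrr.
  rewrite map_inj_uniq ?iota_uniq // => i j /eqP.
  by rewrite eqr_nat eqn_add2l => /eqP.
by rewrite size_map size_iota ltnn.
Qed.

Lemma cumulative_hilbert_polynomial (R : realType) (K : fieldType) n
    (J : set {mpoly K[n.+1]}) (B : nat) :
  is_ideal J ->
  (er_map (fun z : int => z%:~R) (regularity J) <= B%:R%:E :> \bar R)%E ->
  exists q : {poly R}, [/\ (size q <= n.+2)%N,
    forall x, q.[x] - q.[x - 1] = (hilbert_poly R J).[x] &
    forall s, (B + n.+1 <= s)%N -> (cumulative_hilbert J s)%:R = q.[s%:R]].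
Proof.
move=> iJ /regularity_resolution[F shF].
have [p [sp pP]] := hilbert_function_resolution F R iJ.
have HFp s : (B + n.+1 <= s)%N -> (hilbert_function J s)%:R = p.[s%:R].
  move=> Bs; apply: pP => i j; rewrite -(ler_int R).
  by apply: le_trans (shF i j) _; rewrite -natrD ler_nat.
have -> : hilbert_poly R J = p.
  apply: xget_unique; first by exists (B + n.+1)%N.
  move=> p' [t0 p'P]; apply: (@poly_eq_large_nat _ _ _ (maxn t0 (B + n.+1))) => s.
  by rewrite geq_max => /andP[h1 h2]; rewrite -p'P // HFp.
have [q [sq qP]] := antidifference sp.
(* The constant of summation absorbs the degrees in which the Hilbert function need not be
   polynomial yet. *)
pose c := (cumulative_hilbert J (B + n.+1))%:R - q.[(B + n.+1)%:R].
exists (q + c%:P); split=> [|x|s].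
- apply: leq_trans (size_polyD _ _) _; rewrite geq_max sq.
  exact: leq_trans (size_polyC_leq1 _) _.
- by rewrite !hornerD !hornerC -qP; ring.
move=> /subnK <-; elim: (s - _)%N => [|k IH].
  by rewrite add0n hornerD hornerC /c addrC subrK.
move: IH; rewrite addSn hornerD hornerC => IH.
rewrite hornerD hornerC cumulative_hilbertE // big_ord_recr /= -cumulative_hilbertE //.
rewrite natrD IH HFp; last by rewrite -addSn leq_addl.
by rewrite -qP -natr1 addrK; ring.
Qed.

Theorem theorem15 (R : realType) (K : closedFieldType) (n : nat)
    (I : set (coord_ring K n)) :
  [pchar K] =i pred0 -> (0 < n)%N ->
  is_ideal I -> is_homogeneous I -> is_radical I -> LBSR R I ->
  exists p : {poly R}, forall t : R,
    cvgn (aHP_seq I t) /\ aHP I t = p.[t].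
Proof.
move=> _ _ _ _ _ [a [b [a0 b0 [m0 _ regP]]]].
pose A := Num.bound a; pose B := Num.bound b.
have bound m : a * m%:R + b <= (A * m + B)%:R.
  by rewrite natrD natrM lerD ?ler_wpM2r // ltW // archi_boundP // ltW.
(* The size bound is kept for every [m], with the value 0 below [m0], since interpolation is applied
   to the whole sequence. *)
have exq m : exists q : {poly R}, (size q <= n.+2)%N /\ ((m0 <= m)%N ->
    (forall x, q.[x] - q.[x - 1] = (hilbert_poly R (symbolic_pow I m)).[x]) /\
    forall s, (A * m + B + n.+1 <= s)%N ->
      (cumulative_hilbert (symbolic_pow I m) s)%:R = q.[s%:R]).
  have [mm|_] := leqP m0 m; last by exists 0; rewrite size_poly0.
  have [||q [sq qd qc]] := @cumulative_hilbert_polynomial R K n (symbolic_pow I m) (A * m + B).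
  - exact: symbolic_pow_ideal.
  - by apply: le_trans (regP m mm) _; rewrite lee_fin.
  by exists q.
have [q qP] := choice exq.
(* The nodes are chosen so that m T(i) >= Am + B + n + 1 for every m >= 1. *)
pose T i := (A + B + n.+1 + i)%N.
pose r m := m%:R ^- n.+1 *: (q m \Po (m%:R *: 'X)).
have rE m x : (r m).[x] = (q m).[m%:R * x] / m%:R ^+ n.+1.
  by rewrite hornerZ horner_comp hornerZ hornerX mulrC.
have sr m : (size (r m) <= n.+2)%N.
  apply: leq_trans (size_scale_leq _ _) _.
  apply: leq_trans (size_comp_poly_leq _ _) _; rewrite ltnS -[n.+1]muln1.
  apply: leq_mul; first by have := (qP m).1; case: (size _).
  by rewrite -subn1 leq_subLR (leq_trans (size_scale_leq _ _)) // size_polyX.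
have TI : injective (fun i => (T i)%:R : R).
  by move=> i j /eqP; rewrite eqr_nat eqn_add2l => /eqP.
have rT i : cvgn (fun m => (r m).[(T i)%:R]).
  pose c m := cumulative_hilbert (symbolic_pow I m) (m * T i).
  have /cvg_ex[l cl] := @cvg_subhomogeneous R n.+1 c
    (fun m p k _ k0 mpk => cumulative_hilbert_symbolic I (T i) k0 mpk).
  apply/cvg_ex; exists l; apply: (cvg_trans _ cl); apply: near_eq_cvg.
  near=> m; rewrite rE -natrM.
  have m1 : (0 < m)%N by near: m; apply: nbhs_infty_ge.
  have [|_ <- //] := (qP m).2; first by near: m; apply: nbhs_infty_ge.
  rewrite /T !mulnDr -addnA mulnC -!addnA leq_add2l.
  by rewrite leq_add ?leq_pmull // (leq_trans (leq_pmull n.+1 m1)) // leq_addr.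
have [p pP] := cvg_interpolated_diff TI sr rT.
exists p => t; suff ct : aHP_seq I t @ \oo --> p.[t].
  by split; [apply/cvg_ex; exists p.[t] | apply: cvg_lim].
apply: (cvg_trans _ (pP t)); apply: near_eq_cvg; near=> m.
have m1 : (0 < m)%N by near: m; apply: nbhs_infty_ge.
have mR : m%:R != 0 :> R by rewrite pnatr_eq0 -lt0n.
have [|hpE _] := (qP m).2; first by near: m; apply: nbhs_infty_ge.
rewrite /aHP_seq -hpE !rE.
(* A step 1/m in [r m] is a unit step in [q m], whose backward difference is the Hilbert polynomial;
   the factor m turns m^(n+1) into m^n. *)
have -> : m%:R * (t - m%:R^-1) = m%:R * t - 1 by rewrite mulrBr mulfV.
by rewrite -mulrBl exprS mulrCA invfM mulVKf.
Unshelve. all: by end_near. Qed.
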